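(* Let $N,T\ge1$ be integers and let $\alpha\in(0,1)$ be such that $\alpha T$ is an integer. For any deterministic user scheduling algorithm $\pi$, the worst-case age over the horizon $T$ satisfies $$\sup_{\sigma}\ \frac1T\sum_{t=1}^T\frac1N\sum_{i=1}^N a_i(t)\ \ge\ \frac{T\alpha^2}{2},$$ where the supremum is over all feasible blocking matrices $\sigma$.
   Context: A base station serves $N$ users over time slots $1,\dots,T$, at most one user per slot. A deterministic user scheduling algorithm selects the user to be served in each slot $t$ as a deterministic function of $t$ and of the past (users served in earlier slots and whether those transmissions succeeded). A blocking matrix is $\sigma\in\{0,1\}^{N\times T}$; $\sigma_i(t)=0$ means the adversary blocks user $i$ in slot $t$, and $\sigma_i(t)=1$ means it does not. It is feasible if $\sum_{i=1}^N\sum_{t=1}^T(1-\sigma_i(t))\le\alpha T$ and $\sum_{i=1}^N(1-\sigma_i(t))\le 1$ for each $t$. The adversary knows the deterministic algorithm when choosing $\sigma$. Age process: $a_i(1)=1$; $a_i(t+1)=1$ if user $i$ is selected in slot $t$ and $\sigma_i(t)=1$; otherwise $a_i(t+1)=a_i(t)+1$. *)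

(* Defs.v *)
(* MathComp world, with the real numbers of MathComp-Analysis. *)
From HB Require Import structures.
From mathcomp Require Import all_boot all_order all_algebra.
From mathcomp Require Import all_classical reals.

Set Implicit Arguments.
Unset Strict Implicit.
Unset Printing Implicit Defensive.

Import Order.TTheory GRing.Theory Num.Theory.

Local Open Scope ring_scope.

(* What is observed in one slot: [None] if no user is served, otherwise the
   user served and whether the transmission succeeded. *)
Definition outcome (N : nat) := option ('I_N * bool).

(* [pi t h] is the user served in slot [t] (if any), where [h] lists the
   outcomes of slots 1, ..., t - 1 in chronological order. *)
Definition algorithm (N : nat) := nat -> seq (outcome N) -> option 'I_N.

(* Column [s : 'I_T] of a blocking matrix is slot [s.+1]; [true] encodes 1
   (not blocked) and [false] encodes 0 (blocked). *)
Definition blocking_matrix (N T : nat) := 'M[bool]_(N, T).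

Definition feasible (R : realType) (N T : nat) (alpha : R)
    (sigma : blocking_matrix N T) : Prop :=
  (\sum_(i < N) \sum_(s < T) (1 - sigma i s))%N%:R <= alpha * T%:R
  /\ forall s : 'I_T, (\sum_(i < N) (1 - sigma i s) <= 1)%N.

(* The entry of [sigma] for slot [t], 1 <= t <= T. The ages in slots 1, ..., T
   do not depend on the value given to other [t]. *)
Definition entry (N T : nat) (sigma : blocking_matrix N T) (i : 'I_N)
    (t : nat) : bool :=
  if insub t.-1 is Some s then sigma i s else true.

(* The outcomes of slots 1, ..., t. *)
Fixpoint history (N T : nat) (pi : algorithm N) (sigma : blocking_matrix N T)
    (t : nat) : seq (outcome N) :=
  if t is s.+1 then
    let h := history pi sigma s in
    rcons h (omap (fun i => (i, entry sigma i t)) (pi t h))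
  else [::].

Definition selected (N T : nat) (pi : algorithm N)
    (sigma : blocking_matrix N T) (t : nat) : option 'I_N :=
  pi t (history pi sigma t.-1).

(* The age a_i(t) for t >= 1; the value at 0 is irrelevant. *)
Fixpoint age (N T : nat) (pi : algorithm N) (sigma : blocking_matrix N T)
    (i : 'I_N) (t : nat) : nat :=
  match t with
  | 0 => 0
  | 1 => 1
  | s.+1 => if (selected pi sigma s == Some i) && entry sigma i s then 1
            else (age pi sigma i s).+1
  end%N.

Definition average_age (R : realType) (N T : nat) (pi : algorithm N)
    (sigma : blocking_matrix N T) : R :=
  T%:R^-1 * \sum_(1 <= t < T.+1)
    (N%:R^-1 * \sum_(i < N) (age pi sigma i t)%:R).

(* The supremum is over a finite set which, for alpha >= 0, is nonempty (the
   all-ones matrix is feasible), so [sup] does not take its default value. *)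
Definition worst_case_age (R : realType) (N T : nat) (alpha : R)
    (pi : algorithm N) : R :=
  sup [set average_age R pi sigma
      | sigma in [set sigma : blocking_matrix N T | feasible alpha sigma]]%classic.

(* Main.v *)
(* The adversary blocks whichever user is selected in each of the first
   [K = alpha T] slots. Nobody is served there, so every age equals [t] at each
   time [t <= K], and these slots alone contribute [K (K + 1) / 2] per user to
   the sum of the ages. *)
Require Import Defs.
From HB Require Import structures.
From mathcomp Require Import all_boot all_order all_algebra.
From mathcomp Require Import all_classical reals.

Import Order.TTheory GRing.Theory Num.Theory.

Local Open Scope ring_scope.

(* Since the algorithm is deterministic, the history that it sees when all its
   transmissions fail can be computed before any blocking matrix is chosen. *)
Fixpoint failed_history {N : nat} (pi : algorithm N) (t : nat) :
    seq (outcome N) :=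
  if t is s.+1 then
    let h := failed_history pi s in
    rcons h (omap (fun i => (i, false)) (pi t h))
  else [::].

(** The test uses [failed_history] because the actual history depends on the matrix being defined.
    [history_jam] shows that the two agree through slot [K]. *)
Definition jam (N T K : nat) (pi : algorithm N) : blocking_matrix N T :=
  \matrix_(i, s) ~~ ((s < K)%N && (pi s.+1 (failed_history pi s) == Some i)).

Section Jamming.
Context {N : nat} (T K : nat) (pi : algorithm N) (leKT : (K <= T)%N).

Lemma entry_jam (i : 'I_N) (t : nat) : (t < K)%N ->
  entry (jam N T K pi) i t.+1 = (pi t.+1 (failed_history pi t) != Some i).
Proof.
move=> ltK; rewrite /entry /=.
by rewrite (insubT (fun x => x < T)%N (leq_trans ltK leKT)) mxE /= ltK.
Qed.

(** By induction: once the pasts agree, the user that [pi] selects is the one that [jam] blocks, so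
    the next outcome is again a failure. *)
Lemma history_jam (t : nat) : (t <= K)%N ->
  history pi (jam N T K pi) t = failed_history pi t.
Proof.
elim: t => [//|t IH] ltK; rewrite /= IH 1?ltnW//.
congr rcons; case E: (pi _ _) => [i|//] /=.
by rewrite entry_jam// E eqxx.
Qed.

Lemma age_jam (i : 'I_N) (t : nat) : (t <= K)%N ->
  age pi (jam N T K pi) i t = t.
Proof.
elim: t => [//|[//|t] IH] ltK.
have -> : age pi (jam N T K pi) i t.+2 =
    if (selected pi (jam N T K pi) t.+1 == Some i)
         && entry (jam N T K pi) i t.+1
    then 1%N else (age pi (jam N T K pi) i t.+1).+1 by [].
have ltK' : (t < K)%N by exact: ltnW.
(* With the histories identified, the condition for resetting the age has the form [b && ~~ b]. *)
by rewrite IH// entry_jam// /selected /= history_jam 1?ltnW// andbN.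
Qed.

(** The bound [s < K], read as 0 or 1, serves both feasibility constraints: it is at most 1 in each
    slot and sums to [K] over all slots. *)
Lemma jam_column (s : 'I_T) :
  (\sum_(i < N) (1 - jam N T K pi i s) <= (s < K))%N.
Proof.
under eq_bigr do rewrite mxE.
case: (s < K)%N => /=; last by rewrite big1.
case: (pi _ _) => [j|]; last by rewrite big1.
rewrite (bigD1 j)//= eqxx big1 // => i ij.
by rewrite (_ : (Some j == Some i) = (j == i))// eq_sym (negbTE ij).
Qed.

Lemma jam_total : (\sum_(i < N) \sum_(s < T) (1 - jam N T K pi i s) <= K)%N.
Proof.
rewrite exchange_big /=.
apply: leq_trans (leq_sum _ (fun s _ => jam_column s)) _.
rewrite -big_mkcond /= -(big_ord_widen T (fun=> 1%N))//.
by rewrite sum_nat_const card_ord muln1.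
Qed.

Lemma sum_age_jam (i : 'I_N) :
  (K * K <= 2 * \sum_(1 <= t < T.+1) age pi (jam N T K pi) i t)%N.
Proof.
rewrite (big_cat_nat (n := K.+1))//= mulnDr.
apply: leq_trans (leq_addr _ _).
rewrite (eq_big_nat _ _ (F2 := id)) => [|t /andP[_ tK]]; last exact: age_jam.
(* The inductive step is $(k+1)^2 \le k^2 + 2(k+1)$. *)
elim: K => [//|k IH]; rewrite big_nat_recr//= mulnDr.
apply: leq_trans (leq_add IH (leqnn _)).
by rewrite mulSn mulnS addnA addnC leq_add2l mul2n -addnn leq_add2l.
Qed.

End Jamming.

Lemma average_age_ge0 (R : realType) (N T : nat) (pi : algorithm N)
  (sigma : blocking_matrix N T) : 0 <= average_age R pi sigma.
Proof.
apply: mulr_ge0; rewrite ?invr_ge0//; apply: sumr_ge0 => t _.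
by apply: mulr_ge0; rewrite ?invr_ge0//; apply: sumr_ge0 => i _.
Qed.

Lemma average_age_le_worst_case (R : realType) (N T : nat) (alpha : R)
    (pi : algorithm N) (sigma : blocking_matrix N T) :
  feasible alpha sigma -> average_age R pi sigma <= worst_case_age T alpha pi.
Proof.
move=> fs; apply: ub_le_sup; last by exists sigma.
(* There are finitely many matrices and average ages are nonnegative, so the sum of all of them
   bounds each one. *)
exists (\sum_(tau : blocking_matrix N T) average_age R pi tau) => _ [tau _ <-].
rewrite (bigD1 tau)//= lerDl sumr_ge0// => ? _; exact: average_age_ge0.
Qed.

Lemma average_age_jam_ge (R : realType) (N T K : nat) (pi : algorithm N) :
  (0 < N)%N -> (K <= T)%N ->
  T%:R^-1 * (K%:R ^+ 2 / 2) <= average_age R pi (jam N T K pi).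
Proof.
move=> N0 leKT; apply: ler_wpM2l; first by rewrite invr_ge0.
(* With the sum over users outermost, it suffices that each user contributes at least $K^2/2$; the
   factor [N] cancels the averaging. *)
rewrite -mulr_sumr [leRHS]mulrC ler_pdivlMr ?ltr0n// exchange_big /=.
have -> : K%:R ^+ 2 / 2 * N%:R = \sum_(i < N) (K%:R ^+ 2 / 2) :> R.
  by rewrite sumr_const card_ord mulr_natr.
apply: ler_sum => i _; rewrite ler_pdivrMr// -natr_sum -natrX -natrM ler_nat.
by rewrite mulnC -mulnn sum_age_jam.
Qed.

Theorem lemma1 (R : realType) (N T : nat) (alpha : R)
    (hN : (1 <= N)%N) (hT : (1 <= T)%N)
    (halpha0 : 0 < alpha) (halpha1 : alpha < 1)
    (halphaT : alpha * T%:R \is a Num.int) (pi : algorithm N) :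
  worst_case_age T alpha pi >= T%:R * alpha ^+ 2 / 2.
Proof.
have T0 : 0 < T%:R :> R by rewrite ltr0n.
have /natrP[K eK] : alpha * T%:R \is a Num.nat.
  by rewrite natrEint halphaT mulr_ge0// ltW.
have leKT : (K <= T)%N by rewrite -(ler_nat R) -eK ler_piMl// ltW.
have fj : feasible alpha (jam N T K pi).
  split=> [|s]; first by rewrite eK ler_nat jam_total.
  exact: leq_trans (jam_column _ _ _ _) (leq_b1 _).
apply: le_trans (average_age_le_worst_case _ _ _ _ pi _ fj).
apply: le_trans (average_age_jam_ge R N T K pi hN leKT).
(* Substituting $K = \alpha T$, one factor of $T$ cancels against $T^{-1}$. *)
rewrite -eK exprMn mulrA [alpha ^+ 2 * _]mulrC [T%:R ^+ 2]expr2 !mulrA.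
by rewrite mulVf ?mul1r// gt_eqF.
Qed.
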